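(* Let $\mathfrak{g}_0$ be a compact semisimple real Lie algebra, $\mathfrak{h}_0$ a maximal abelian subalgebra of $\mathfrak{g}_0$, $U$ a finite dimensional real $\mathfrak{g}_0$-module, and $\{\mathfrak{n}_0=U\oplus\mathfrak{g}_0,\langle\,,\rangle\}$ the real 2-step nilpotent Lie algebra described in the context. Let $V=U^{\mathbb{C}}$, $\mathfrak{h}=\mathfrak{h}_0^{\mathbb{C}}$, $\mathfrak{g}=\mathfrak{g}_0^{\mathbb{C}}$, let $\Lambda\subset\mathrm{Hom}(\mathfrak{h},\mathbb{C})$ be the set of (nonzero) weights of $V$ determined by $\mathfrak{h}$, and let $U=U_0+\sum_{\lambda\in\Lambda^+}U_\lambda$ (direct sum) be the corresponding weight space decomposition of $U$. Then, for the bracket of $\mathfrak{n}_0$: 1) $[U_0,U_\lambda]=\mathfrak{g}_{0,\lambda}$ for all $\lambda\in\Lambda$. 2) $[U_\mu,U_\lambda]=\mathfrak{g}_{0,\mu+\lambda}\oplus\mathfrak{g}_{0,\mu-\lambda}$ for all $\mu,\lambda\in\Lambda$ with $\mu+\lambda\neq0$. 3) $[U_0,U_0]=\{0\}$.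
   Context: A compact semisimple real Lie algebra is one whose Killing form is negative definite. $\langle\,,\rangle$ is a positive definite inner product on $\mathfrak{n}_0=U\oplus\mathfrak{g}_0$ such that $U\perp\mathfrak{g}_0$, every $X\in\mathfrak{g}_0$ acts skew symmetrically on $U$, and $\mathrm{ad}X:\mathfrak{g}_0\to\mathfrak{g}_0$ is skew symmetric for every $X\in\mathfrak{g}_0$. The bracket of $\mathfrak{n}_0$ is defined by: $\mathfrak{g}_0$ is central in $\mathfrak{n}_0$, $[\mathfrak{n}_0,\mathfrak{n}_0]\subseteq\mathfrak{g}_0$, and $\langle[u,u'],Z\rangle=\langle Z(u),u'\rangle$ for $u,u'\in U$, $Z\in\mathfrak{g}_0$. $V_\lambda=\{v\in V:Hv=\lambda(H)v\ \forall H\in\mathfrak{h}\}$, $V_0$ is the zero weight space, $U_\lambda=(V_\lambda\oplus V_{-\lambda})\cap U$ for $\lambda\in\Lambda$, $U_0=V_0\cap U$, and $\Lambda^+$ is any subset of $\Lambda$ such that $\Lambda$ is the disjoint union of $\Lambda^+$ and $-\Lambda^+$. $\Phi$ is the root system of $\mathfrak{h}$ in $\mathfrak{g}$, $\mathfrak{g}_\beta$ are the root spaces, $\mathfrak{g}_{0,\beta}=(\mathfrak{g}_\beta\oplus\mathfrak{g}_{-\beta})\cap\mathfrak{g}_0$ for $\beta\in\Phi$, and the convention is that $\mathfrak{g}_{0,\lambda}=\{0\}$ if $\lambda\notin\Phi$. For subspaces $A,B$, $[A,B]$ is the span of all $[a,b]$ with $a\in A$, $b\in B$.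
   Formalization: In 2) the condition μ−λ≠0 is added to μ+λ≠0: for μ=λ the claim fails for every weight, since g_{0,0}={0} by convention and g_{0,2λ} is orthogonal to h_0, while ⟨[u,Hu],H⟩=|Hu|²>0 for H in h_0 with λ(H)≠0 and 0≠u in U_λ. *)

(* Defs.v *)
From HB Require Import structures.
From mathcomp Require Import all_boot all_order all_algebra.
From mathcomp Require Import sesquilinear complex.
From mathcomp Require Import boolp classical_sets functions cardinality fsbigop.
From mathcomp Require Import reals.

Set Implicit Arguments.
Unset Strict Implicit.
Unset Printing Implicit Defensive.

Import Order.TTheory GRing.Theory Num.Theory.

Local Open Scope classical_set_scope.
Local Open Scope ring_scope.

(* W^C as pairs (x, y) standing for x + i y, with scalars in R[i]. *)
Definition complexification (R : realType) (W : vectType R) : Type :=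
  (W * W)%type.

Section Complexification.
Import VectorInternalTheory.
Variables (R : realType) (W : vectType R).
Local Notation WC := (complexification W).

HB.instance Definition _ := GRing.Zmodule.copy WC (W * W)%type.

Definition cscale (c : R[i]) (w : WC) : WC :=
  (complex.Re c *: w.1 - complex.Im c *: w.2, complex.Re c *: w.2 + complex.Im c *: w.1).

Fact cscaleA (a b : R[i]) (w : WC) : cscale a (cscale b w) = cscale (a * b) w.
Proof.
case: a b w => [a1 a2] [b1 b2] [x y]; rewrite /cscale /=; congr pair.
- rewrite !(scalerBr, scalerDr, scalerBl, scalerDl) !scalerA !opprD.
  by rewrite [X in _ + X = _]addrC addrACA.
- rewrite (scalerDr a1) (scalerBr a2) scalerBl scalerDl !scalerA.
  by rewrite [X in _ + X = _]addrC addrACA.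
Qed.

Fact cscale1 : left_id 1 cscale.
Proof. by case=> x y; rewrite /cscale /= !scale1r !scale0r subr0 addr0. Qed.

Fact cscaleDr : right_distributive cscale +%R.
Proof.
move=> [a b] [x y] [z t]; rewrite /cscale /=; congr pair => /=.
- by rewrite !scalerDr opprD addrACA.
- by rewrite !scalerDr addrACA.
Qed.

Fact cscaleDl (w : WC) : {morph cscale^~ w : a b / a + b}.
Proof.
case: w => x y [a b] [c d]; rewrite /cscale /=; congr pair => /=.
- by rewrite !scalerDl opprD addrACA.
- by rewrite !scalerDl addrACA.
Qed.

HB.instance Definition _ :=
  GRing.Zmodule_isLmodule.Build R[i] WC cscaleA cscale1 cscaleDr cscaleDl.

Definition c2r (w : WC) : 'rV[R[i]]_(dim W) :=
  \row_j Complex (v2r w.1 0 j) (v2r w.2 0 j).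
Definition r2c (r : 'rV[R[i]]_(dim W)) : WC :=
  (r2v (\row_j complex.Re (r 0 j)), r2v (\row_j complex.Im (r 0 j))).

Fact complexification_vect_axiom : vector_axiom_def (dim W) WC.
Proof.
exists c2r.
- move=> [a b] [x y] [z t]; apply/rowP => j; rewrite !mxE /=.
  by rewrite !linearD !linearN !linearZ /= !mxE mulrN.
- exists r2c.
  + move=> [x y]; rewrite /r2c /c2r; congr pair; rewrite -[RHS]v2rK;
    congr r2v; apply/rowP => j; rewrite !mxE //.
  + move=> r; apply/rowP => j; rewrite !mxE /= !r2vK !mxE.
    by case: (r 0 j).
Qed.

HB.instance Definition _ :=
  Lmodule_hasFinDim.Build R[i] WC complexification_vect_axiom.

Definition real_vec (w : W) : WC := (w, 0).

End Complexification.

(* C-bilinear extension of an R-bilinear map. *)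
Definition cbilin (R : realType) (A B D : vectType R) (f : A -> B -> D)
    (a : complexification A) (b : complexification B) : complexification D :=
  (f a.1 b.1 - f a.2 b.2, f a.1 b.2 + f a.2 b.1).

Section LieAlgebra.
Variables (R : realType).

Definition is_lie_bracket (g : vectType R) (br : {bilinear g -> g -> g}) :=
  (forall x, br x x = 0) /\
  (forall x y z, br x (br y z) + br y (br z x) + br z (br x y) = 0).

Definition is_lie_module (g U : vectType R) (br : {bilinear g -> g -> g})
    (act : {bilinear g -> U -> U}) :=
  forall x y u, act (br x y) u = act x (act y u) - act y (act x u).

Definition lfun_trace (W : vectType R) (f : 'End(W)) : R :=
  \tr (passmx.mxof (vbasis {:W}) (vbasis {:W}) f).

Definition killing (g : vectType R) (br : {bilinear g -> g -> g})
    (x y : g) : R :=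
  lfun_trace (linfun (br x) \o linfun (br y))%VF.

Definition is_compact_semisimple (g : vectType R)
    (br : {bilinear g -> g -> g}) :=
  is_lie_bracket br /\ (forall x, x != 0 -> killing br x x < 0).

Definition is_abelian_subspace (g : vectType R) (br : {bilinear g -> g -> g})
    (h : {vspace g}) :=
  forall x y, x \in h -> y \in h -> br x y = 0.

(* An abelian subspace is automatically a subalgebra. *)
Definition is_maximal_abelian (g : vectType R) (br : {bilinear g -> g -> g})
    (h : {vspace g}) :=
  is_abelian_subspace br h /\
  (forall k : {vspace g}, is_abelian_subspace br k -> (h <= k)%VS -> k = h).

Definition is_inner_product (W : vectType R) (ip : {biscalar W}) :=
  (forall x y, ip x y = ip y x) /\ (forall x, x != 0 -> 0 < ip x x).

End LieAlgebra.

Section Subspaces.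
Variables (K : nzRingType) (W : lmodType K).

Definition linear_span (S : set W) : set W :=
  [set w | exists (n : nat) (c : 'I_n -> K) (s : 'I_n -> W),
     (forall i, S (s i)) /\ w = \sum_(i < n) c i *: s i].

Definition bracket_span (br : W -> W -> W) (A B : set W) : set W :=
  linear_span [set br a b | a in A & b in B].

Definition sum_set (A B : set W) : set W := [set a + b | a in A & b in B].

Definition is_direct_sum (S A B : set W) :=
  S = sum_set A B /\ A `&` B = [set 0].

End Subspaces.

Section TwoStepNilpotent.
Variables (R : realType) (g U : vectType R).
Local Notation n0 := (U * g)%type.

Definition inU (u : U) : n0 := (u, 0).
Definition ing (x : g) : n0 := (0, x).

Definition is_adapted_inner_product (br : {bilinear g -> g -> g})
    (act : {bilinear g -> U -> U}) (ip : {biscalar n0}) :=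
  [/\ is_inner_product ip,
      forall u x, ip (inU u) (ing x) = 0,
      forall x u u', ip (inU (act x u)) (inU u') = - ip (inU u) (inU (act x u'))
    & forall x y z, ip (ing (br x y)) (ing z) = - ip (ing y) (ing (br x z))].

(* These conditions determine nbr uniquely, since ip is nondegenerate on g. *)
Definition is_two_step_bracket (act : {bilinear g -> U -> U})
    (ip : {biscalar n0}) (nbr : {bilinear n0 -> n0 -> n0}) :=
  [/\ is_lie_bracket nbr,
      forall x v, nbr (ing x) v = 0,
      forall v w, exists x, nbr v w = ing x
    & forall u u' z, ip (nbr (inU u) (inU u')) (ing z) = ip (inU (act z u)) (inU u')].

End TwoStepNilpotent.

Section Weights.
Variables (R : realType) (g : vectType R) (h0 : {vspace g}).

(* h = h0^C, an abstract complex space whose elements are mapped to g^C by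
   cartan_incl. *)
Definition cartan := complexification (subvs_of h0).

Definition cartan_incl (H : cartan) : complexification g :=
  (vsval H.1, vsval H.2).

Definition cartan_dual := 'Hom(cartan, R[i]^o).

Section Module.
Variables (W : vectType R) (act : {bilinear g -> W -> W}).

Definition weight_space (l : cartan_dual) : set (complexification W) :=
  [set v | forall H : cartan, cbilin act (cartan_incl H) v = (l H : R[i]) *: v].

Definition weights : set cartan_dual :=
  [set l | l <> 0 /\ exists v, v <> 0 /\ weight_space l v].

Definition real_zero_weight_space : set W :=
  [set u | weight_space 0 (real_vec u)].

Definition real_weight_space (l : cartan_dual) : set W :=
  [set u | sum_set (weight_space l) (weight_space (- l)) (real_vec u)].

Definition is_positive_half (Lp : set cartan_dual) :=
  weights = Lp `|` [set - l | l in Lp] /\ Lp `&` [set - l | l in Lp] = set0.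

(* W is the direct sum of W_0 and the W_l for l in Lp: every vector is uniquely
   w0 + \sum_l w_l.  Families indexed by Lp are encoded as functions on the
   whole dual that vanish off Lp; the sum is genuine because the set of weights
   is finite. *)
Definition is_weight_decomposition (Lp : set cartan_dual) :=
  forall w : W, exists! p : W * (cartan_dual -> W),
    [/\ real_zero_weight_space p.1,
        forall l, Lp l -> real_weight_space l (p.2 l),
        forall l, ~ Lp l -> p.2 l = 0
      & w = p.1 + \sum_(l \in Lp) p.2 l].

End Module.

Definition roots (br : {bilinear g -> g -> g}) : set cartan_dual := weights br.

(* {0} off the root system; in particular at b = 0. *)
Definition real_root_space (br : {bilinear g -> g -> g}) (b : cartan_dual) :
    set g :=
  if `[< roots br b >] then real_weight_space br b else [set 0].

End Weights.

(* Main.v *)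
Require Import Defs.
From HB Require Import structures.
From mathcomp Require Import all_boot all_order all_algebra.
From mathcomp Require Import sesquilinear complex.
From mathcomp Require Import boolp classical_sets functions cardinality fsbigop.
From mathcomp Require Import reals.
From mathcomp Require Import spectral ring lra.

Set Implicit Arguments.
Unset Strict Implicit.
Unset Printing Implicit Defensive.

Import Order.TTheory GRing.Theory Num.Theory.

Local Open Scope classical_set_scope.
Local Open Scope ring_scope.

(** Everything is moved from complex weight spaces to real pairs of vectors.
Since the action of h0 on U is skew, a weight takes imaginary values on h0: it
is i a for a real functional a, and x + i y lies in V_l exactly when
H x = - a(H) y and H y = a(H) x for every H in h0.  These are the pairs
[weight_pair]; the real weight space of l is the set [re_weight] of their real
parts, and for l = 0 it is the zero weight space.

The bracket of n0 restricted to U is the map mom : U x U -> g0 defined by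
<mom u v, Z> = <Z u, v>.  It is g0-equivariant, so its complexification sends
V_l x V_m into g_(l + m), and passing to real parts gives the inclusions from
left to right in 1) and 2).  For 3), mom u v commutes with h0 when u and v have
weight zero, so it lies in h0 by maximality, and it is orthogonal to h0 because
h0 kills u.

For the reverse inclusions take Z in g_(0, l + m) orthogonal to mom(U_l, U_m),
which means <Z u, v> = 0 for u in U_l and v in U_m, and write Z = A for a root
pair (A, B), X = A + i B.  The key lemma [root_pairing_nondegenerate] shows
that Z = 0.  Indeed X then maps V_(-l) to 0 and V_(-m) to 0.  As in the
representation theory of sl2, T = [A, B] lies in h0 and the identity
a_l(T) |x|^2 = |A x|^2 + |B x|^2 for x in U_l gives a_l(T) >= 0 when U_l is
nonzero; likewise a_m(T) >= 0.  But the same computation in g0 gives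
a_(l + m)(T) |A|^2 = - |T|^2, where T is nonzero when A is, a contradiction.
In 2) the spaces g_(0, m + l) and g_(0, m - l) are orthogonal to each other and
[mom_set_split] lets them be treated one at a time.

The weight space decomposition rests on the existence of a common eigenvector
for h0 in the complexification of the orthogonal complement of the span of all
weight vectors, which forces this complement to vanish, and on the
orthogonality of U_l and U_m for l <> m, - m. *)

(** * Orthogonal projections and spans *)

Section InnerProduct.
Variables (R : realType) (W : vectType R) (ip : {biscalar W}).
Hypothesis ip_inner : is_inner_product ip.

Lemma ipC x y : ip x y = ip y x.
Proof. by case: ip_inner => + _; apply. Qed.

Lemma ip_ge0 x : 0 <= ip x x.
Proof.
have [->|x0] := eqVneq x 0; first by rewrite linear0l.
by apply/ltW; case: ip_inner => _; apply.
Qed.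

Lemma ip_eq0 x : ip x x = 0 -> x = 0.
Proof.
move=> xx0; apply/eqP/negPn/negP => x0.
by case: ip_inner => _ /(_ x x0); rewrite xx0 ltxx.
Qed.

Lemma ip_span_eq0 (X : seq W) z e :
  (forall x, x \in X -> ip z x = 0) -> e \in <<X>>%VS -> ip z e = 0.
Proof.
move=> zX eX; rewrite (coord_span (X := in_tuple X) eX) linear_sumr big1 // => i _.
by rewrite linearZr_LR /= zX ?mulr0 // mem_nth.
Qed.

(** Gram-Schmidt along the list X: the projection onto the span of the tail is
corrected along the component of the head orthogonal to the tail. *)
Lemma orthogonal_projection (X : seq W) t :
  exists2 e, e \in <<X>>%VS & forall x, x \in X -> ip (t - e) x = 0.
Proof.
elim: X t => [|x X IH] t; first by exists 0; rewrite ?mem0v.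
have [e eX te] := IH t; have [f fX xf] := IH x.
have sub v : v \in <<X>>%VS -> v \in <<x :: X>>%VS.
  by rewrite span_cons => vX; rewrite -[v]add0r memv_add ?mem0v.
have xin : x \in <<x :: X>>%VS by rewrite memv_span // mem_head.
(* The vector x - f is orthogonal to f. *)
have xE : ip (x - f) x = ip (x - f) (x - f).
  by rewrite linearBr (ip_span_eq0 xf fX) subr0.
have [xf0|xf0] := eqVneq (x - f) 0.
  exists e => [|y]; first exact: sub.
  rewrite in_cons => /predU1P[->|]; last exact: te.
  by move/subr0_eq: xf0 => ->; exact: ip_span_eq0 te fX.
have n0 : ip (x - f) (x - f) != 0 by apply: contra_neq xf0 => /ip_eq0.
pose c := ip (t - e) x / ip (x - f) (x - f).
exists (e + c *: (x - f)) => [|y].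
  by apply: memvD; [exact: sub | apply/memvZ/memvB => //; exact: sub].
rewrite opprD addrA linearBl linearZl_LR /= in_cons => /predU1P[->|yX].
  by rewrite xE /c divfK // subrr.
by rewrite te // xf // mulr0 subrr.
Qed.

End InnerProduct.

(** Greedy choice: as long as S is not contained in the span, adding a vector of S
raises the dimension.  This replaces an arbitrary set of vectors by a list, for
which orthogonal projections exist. *)
Lemma finite_spanning_subset (R : realType) (W : vectType R) (S : set W) :
  exists2 X : seq W, (forall x, x \in X -> S x) & forall s, S s -> s \in <<X>>%VS.
Proof.
(* Either the dimension reaches n or the span already contains S. *)
have grow n : exists2 X : seq W, (forall x, x \in X -> S x) &
    (n <= \dim <<X>>)%N \/ forall s, S s -> s \in <<X>>%VS.
  elim: n => [|n [X XS [nX|SX]]]; first by exists [::] => //; left.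
    have [SX|] := pselect (forall s, S s -> s \in <<X>>%VS).
      by exists X => //; right.
    move=> /existsNP[s /not_implyP[Ss /negP sX]].
    exists (s :: X) => [x|]; first by rewrite in_cons => /predU1P[->|/XS].
    left; apply: leq_ltn_trans nX _; rewrite span_cons.
    rewrite (ltn_leqif (dimv_leqif_sup _)) ?addvSr //.
    apply: contra sX => /subvP; apply.
    by apply: (subvP (addvSl _ _)); rewrite memv_line.
  by exists X => //; right.
(* One more than the dimension of W cannot be reached. *)
have [X XS [lX|]] := grow (\dim {:W}).+1; last by exists X.
by move: (leq_trans lX (dimvS (subvf <<X>>))); rewrite ltnn.
Qed.

(** The part of t in T orthogonal to the span of S lies in T again, hence is zero
by hypothesis, so t is its own projection. *)
Lemma linear_span_of_orthogonal (R : realType) (W : vectType R)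
    (ip : {biscalar W}) (S T : set W) :
  is_inner_product ip -> T 0 -> (forall a x y, T x -> T y -> T (a *: x + y)) ->
  S `<=` T -> (forall z, T z -> (forall s, S s -> ip z s = 0) -> z = 0) ->
  linear_span S = T.
Proof.
move=> ipP T0 TP ST Tz.
apply/seteqP; split => [_ [n [c [s [Ss ->]]]]|t Tt].
  by elim/big_rec: _ => // i x _ Tx; apply: TP => //; apply: ST.
have [X XS SX] := finite_spanning_subset S.
have coordX v : v \in <<X>>%VS -> linear_span S v.
  move=> vX; exists (size X), (fun i => coord (in_tuple X) i v), (fun i => nth 0 X i).
  split=> [i|]; first by apply: XS; rewrite mem_nth.
  exact: (coord_span (X := in_tuple X) vX).
have XT v : v \in <<X>>%VS -> T v.
  move=> /(coord_span (X := in_tuple X)) ->.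
  elim/big_rec: _ => // i x _ Tx; apply: TP => //; apply/ST/XS.
  by rewrite mem_nth.
have [e eX te] := orthogonal_projection ipP X t.
suff /eqP : t - e = 0 by rewrite subr_eq0 => /eqP ->; exact: coordX.
apply: Tz => [|s /SX sX]; last exact: ip_span_eq0 te sX.
by rewrite addrC -scaleN1r; apply: TP => //; exact: XT.
Qed.

(** * Weight spaces in real form *)

Lemma complexification_scaleE (R : realType) (W : vectType R) (a b : R) (x y : W) :
  Complex a b *: ((x, y) : complexification W) =
  (a *: x - b *: y, a *: y + b *: x).
Proof. by []. Qed.

Section RealForm.
Variables (R : realType) (g W : vectType R) (h0 : {vspace g}).
Variable act : {bilinear g -> W -> W}.
Implicit Types (l m : cartan_dual h0) (H z : g) (x y : W).

(** The functional a with l = i a on h0; projecting to h0 first makes it a function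
of vectors of g, which avoids carrying subspace proofs. *)
Definition imval l z : R := complex.Im (l (real_vec (vsproj h0 z))).

Definition imaginary l :=
  forall H : subvs_of h0, complex.Re (l (real_vec H)) = 0.

Definition weight_pair l x y :=
  forall H, H \in h0 -> act H x = - imval l H *: y /\ act H y = imval l H *: x.

Lemma cartan_dual_complexE l (H : cartan h0) :
  l H = l (real_vec H.1) + Complex 0 1 * l (real_vec H.2).
Proof.
rewrite -[X in _ + X]/(Complex 0 1 *: (l (real_vec H.2) : R[i]^o)).
rewrite -linearZ -linearD; congr (l _).
case: H => H1 H2; rewrite /real_vec complexification_scaleE /=.
rewrite !scale0r !scale1r; congr pair => /=.
  by rewrite subrr addr0.
by rewrite !add0r.
Qed.

Lemma imaginaryE l (H : subvs_of h0) : imaginary l ->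
  l (real_vec H) = Complex 0 (imval l (vsval H)).
Proof.
by move=> /(_ H); rewrite /imval vsvalK; case: (l _) => a b /= ->.
Qed.

Lemma imaginary0 : imaginary 0.
Proof. by move=> H; rewrite zero_lfunE. Qed.

Lemma imaginaryD l m : imaginary l -> imaginary m -> imaginary (l + m).
Proof. by move=> il im H; rewrite add_lfunE raddfD /= il im addr0. Qed.

Lemma imaginaryN l : imaginary l -> imaginary (- l).
Proof. by move=> il H; rewrite opp_lfunE raddfN /= il oppr0. Qed.

Lemma imval0 z : imval 0 z = 0.
Proof. by rewrite /imval zero_lfunE. Qed.

Lemma imvalD l m z : imval (l + m) z = imval l z + imval m z.
Proof. by rewrite /imval add_lfunE raddfD. Qed.

Lemma imvalN l z : imval (- l) z = - imval l z.
Proof. by rewrite /imval opp_lfunE raddfN. Qed.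

Lemma imval_neq l m : imaginary l -> imaginary m -> l <> m ->
  exists2 H, H \in h0 & imval l H != imval m H.
Proof.
move=> il im lm; apply: contrapT => nE; apply: lm; apply/lfunP => H.
have eq_re K : l (real_vec K) = m (real_vec K).
  rewrite !imaginaryE //; congr Complex; apply/eqP/negPn/negP => nK.
  by apply: nE; exists (vsval K) => //; exact: subvsP.
by rewrite [LHS]cartan_dual_complexE [RHS]cartan_dual_complexE !eq_re.
Qed.

Lemma imval_neq0 l : imaginary l -> l <> 0 ->
  exists2 H, H \in h0 & imval l H != 0.
Proof.
move=> il l0; have [H Hh] := imval_neq il imaginary0 l0.
by rewrite imval0; exists H.
Qed.

(** A functional and an action that are complex linear are determined by their
values on real elements, so the eigenvalue equations may be tested on h0. *)
Lemma weight_spaceP l x y : imaginary l ->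
  weight_space act l (x, y) <-> weight_pair l x y.
Proof.
move=> il; split=> [lxy H Hh|lxy [H1 H2]].
  have := lxy (real_vec (vsproj h0 H)); rewrite imaginaryE // vsprojK //.
  rewrite /cbilin /cartan_incl /= vsprojK // !linear0l subr0 addr0.
  rewrite complexification_scaleE !scale0r !add0r => -[-> ->].
  by rewrite scaleNr.
have [h1x h1y] := lxy _ (subvsP H1); have [h2x h2y] := lxy _ (subvsP H2).
rewrite cartan_dual_complexE /= !imaginaryE //.
rewrite /cbilin /cartan_incl /= h1x h1y h2x h2y.
have -> : Complex 0 (imval l (vsval H1)) +
    Complex 0 1 * Complex 0 (imval l (vsval H2)) =
    Complex (- imval l (vsval H2)) (imval l (vsval H1)).
  by congr Complex => /=; ring.
rewrite complexification_scaleE; congr pair.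
  by rewrite addrC !scaleNr.
by rewrite addrC.
Qed.

(** Multiplication of x + i y by - i. *)
Lemma weight_pair_rot l x y : weight_pair l x y -> weight_pair l y (- x).
Proof.
move=> lxy H Hh; have [Hx Hy] := lxy H Hh.
by rewrite Hy linearNr Hx !scalerN !scaleNr !opprK.
Qed.

Lemma weight_pair_conj l x y : weight_pair l x y -> weight_pair (- l) x (- y).
Proof.
move=> lxy H Hh; have [Hx Hy] := lxy H Hh.
by rewrite linearNr Hx Hy imvalN !scalerN !scaleNr !opprK.
Qed.

Lemma weight_pair_linear l a x y x' y' : weight_pair l x y -> weight_pair l x' y' ->
  weight_pair l (a *: x + x') (a *: y + y').
Proof.
move=> lxy lxy' H Hh; have [Hx Hy] := lxy H Hh; have [Hx' Hy'] := lxy' H Hh.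
rewrite !linearPr /= Hx Hy Hx' Hy' !scalerDr !scalerA.
by split; rewrite [in LHS]mulrC.
Qed.

Lemma weight_pair0 l : weight_pair l 0 0.
Proof. by move=> H _; rewrite linear0r !scaler0. Qed.

Definition re_weight l : set W := [set x | exists y, weight_pair l x y].

Lemma re_weight0 l : re_weight l 0.
Proof. by exists 0; exact: weight_pair0. Qed.

Lemma re_weight_linear l a x x' :
  re_weight l x -> re_weight l x' -> re_weight l (a *: x + x').
Proof. by move=> [y lxy] [y' lxy']; exists (a *: y + y'); exact: weight_pair_linear. Qed.

Lemma re_weightZ l a x : re_weight l x -> re_weight l (a *: x).
Proof.
by move=> lx; rewrite -[_ *: _]addr0; apply: re_weight_linear => //; exact: re_weight0.
Qed.

Lemma re_weightD l x x' :
  re_weight l x -> re_weight l x' -> re_weight l (x + x').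
Proof. by rewrite -{2}[x]scale1r; exact: re_weight_linear. Qed.

Lemma re_weightN l x : re_weight (- l) x <-> re_weight l x.
Proof.
split=> -[y lxy]; exists (- y); last exact: weight_pair_conj.
by rewrite -[l]opprK; exact: weight_pair_conj.
Qed.

Lemma re_weight_act l H x : H \in h0 -> re_weight l x -> re_weight l (act H x).
Proof.
move=> Hh [y lxy]; have [-> _] := lxy H Hh; apply: re_weightZ.
by exists (- x); exact: weight_pair_rot.
Qed.

Lemma re_weight_zeroE x :
  re_weight 0 x <-> forall H, H \in h0 -> act H x = 0.
Proof.
split=> [[y lxy] H Hh|hx].
  by have [-> _] := lxy H Hh; rewrite imval0 oppr0 scale0r.
by exists 0 => H Hh; rewrite linear0r hx // imval0 oppr0 !scale0r.
Qed.

(** The zero weight space is the real weight space of the functional 0, so that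
statements on U_0 are the case l = 0 of statements on U_l. *)
Lemma real_zero_weight_spaceE : real_zero_weight_space h0 act = re_weight 0.
Proof.
apply/seteqP; split=> x /=.
  by move=> /(weight_spaceP _ _ imaginary0) hx; exists 0.
move=> /re_weight_zeroE hx; apply/weight_spaceP; first exact: imaginary0.
by move=> H Hh; rewrite linear0r hx // imval0 oppr0 !scale0r.
Qed.

(** The sum of an element of V_l and one of V_(-l), when real, is the real part of
the first plus the conjugate of the second, and both of these lie in V_l. *)
Lemma real_weight_spaceE l : imaginary l ->
  real_weight_space act l = re_weight l.
Proof.
move=> il; apply/seteqP; split=> x /=.
  move=> [[x1 y1] /weight_spaceP lxy1 [[x2 y2] /weight_spaceP lxy2]] [<- _].
  apply: re_weightD; first by exists y1; exact: lxy1.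
  apply/re_weightN; exists y2; apply: lxy2; exact: imaginaryN.
move=> [y lxy]; have lxy2 := weight_pair_linear 2^-1 lxy (weight_pair0 l).
rewrite !addr0 in lxy2; exists (2^-1 *: x, 2^-1 *: y).
  exact/weight_spaceP.
exists (2^-1 *: x, - (2^-1 *: y)).
  by apply/weight_spaceP; [exact: imaginaryN | exact: weight_pair_conj].
congr pair; rewrite /= ?subrr // -scalerDl; apply/esym.
by rewrite -[LHS]scale1r; congr (_ *: _); field.
Qed.

Lemma imaginary_weightP l : imaginary l ->
  weights act l <-> l <> 0 /\ exists2 x, x <> 0 & re_weight l x.
Proof.
move=> il; split=> -[l0 []].
  move=> [x y] [v0 /weight_spaceP lxy]; split=> //.
  have [x0|x0] := pselect (x = 0); last by exists x => //; exists y; exact: lxy.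
  exists y; last by exists (- x); apply/weight_pair_rot/lxy.
  by move=> y0; apply: v0; rewrite x0 y0.
move=> x x0 [y lxy]; split=> //; exists (x, y); split; first by move=> [].
exact/weight_spaceP.
Qed.

End RealForm.

(** * Equivariant maps and skew modules *)

(** The pair on the right consists of the real and imaginary parts of
f(x + i y, x' + i y'). *)
Lemma weight_pair_equivariant (R : realType) (g W1 W2 W3 : vectType R)
    (h0 : {vspace g}) (act1 : {bilinear g -> W1 -> W1})
    (act2 : {bilinear g -> W2 -> W2}) (act3 : {bilinear g -> W3 -> W3})
    (f : {bilinear W1 -> W2 -> W3}) (l m : cartan_dual h0) x y x' y' :
  (forall z u v, act3 z (f u v) = f (act1 z u) v + f u (act2 z v)) ->
  weight_pair act1 l x y -> weight_pair act2 m x' y' ->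
  weight_pair act3 (l + m) (f x x' - f y y') (f x y' + f y x').
Proof.
move=> f_eqv lxy mxy H Hh; have [Hx Hy] := lxy H Hh; have [Hx' Hy'] := mxy H Hh.
rewrite linearBr linearDr !f_eqv Hx Hy Hx' Hy' imvalD.
rewrite !(linearZl_LR, linearZr_LR) /=.
set a := imval l H; set b := imval m H.
set p := f x x'; set q := f y y'; set r := f x y'; set s := f y x'.
rewrite !(scalerDl, scalerDr, scaleNr, scalerN, opprD, opprB, opprK).
split.
  by rewrite (AC (2*2) ((3*2)*(1*4))).
by rewrite (AC (2*2) ((3*1)*(2*4))).
Qed.

Section SkewModule.
Variables (R : realType) (g W : vectType R) (h0 : {vspace g}).
Variables (act : {bilinear g -> W -> W}) (ip : {biscalar W}).
Hypothesis ip_inner : is_inner_product ip.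
Hypothesis act_skew : forall z x y, ip (act z x) y = - ip x (act z y).
Implicit Types (l m : cartan_dual h0) (H z : g) (x y : W).

Lemma skew_diag z x : ip (act z x) x = 0.
Proof.
by have := act_skew z x x; rewrite [X in _ = - X](ipC ip_inner) => ?; lra.
Qed.

(** The real part p satisfies p (|x|^2 + |y|^2) = <z x, x> + <z y, y> = 0. *)
Lemma skew_eigen_re z p q x y : (x, y) <> (0, 0) ->
  act z x = p *: x - q *: y -> act z y = p *: y + q *: x -> p = 0.
Proof.
move=> v0 zx zy.
have := skew_diag z x; have := skew_diag z y; rewrite zx zy.
rewrite linearDl linearBl !linearZl_LR /= (ipC ip_inner y x) => e1 e2.
have e : p * (ip x x + ip y y) = 0 by lra.
have [//|p0] := eqVneq p 0; case: v0.
have xx := ip_ge0 ip_inner x; have yy := ip_ge0 ip_inner y.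
move/eqP: e; rewrite mulf_eq0 (negPf p0) paddr_eq0 //= => /andP[/eqP x0 /eqP y0].
by congr pair; apply: (ip_eq0 ip_inner).
Qed.

Lemma skew_weight_imaginary l : weights act l -> imaginary l.
Proof.
move=> [_ [[x y] [v0 lxy]]] H; have := lxy (real_vec H).
rewrite /cbilin /cartan_incl /= !linear0l subr0 addr0.
case: (l _) => p q; rewrite complexification_scaleE => -[Hx Hy] /=.
exact: skew_eigen_re v0 Hx Hy.
Qed.

(** Skewness gives (a_l - a_m) (<x, x'> + <y, y'>) = 0 and
(a_l + a_m) (<x, x'> - <y, y'>) = 0 on h0; the hypotheses make each scalar
factor nonzero somewhere. *)
Lemma re_weight_orthogonal l m x x' : imaginary l -> imaginary m ->
  l <> m -> l <> - m -> re_weight act l x -> re_weight act m x' -> ip x x' = 0.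
Proof.
move=> il im lm lNm [y lxy] [y' mxy].
have [H Hh nH] := imval_neq il im lm.
have [K Kh nK] := imval_neq il (imaginaryN im) lNm.
have eqs Z : Z \in h0 ->
    (imval l Z - imval m Z) * (ip x x' + ip y y') = 0 /\
    (imval l Z + imval m Z) * (ip x x' - ip y y') = 0.
  move=> Zh; have [Zx Zy] := lxy Z Zh; have [Zx' Zy'] := mxy Z Zh.
  have := act_skew Z x y'; have := act_skew Z y x'; rewrite Zx Zy Zx' Zy'.
  by rewrite !linearZl_LR !linearZr_LR /= => e1 e2; split; lra.
have [e1 _] := eqs _ Hh; have [_ e2] := eqs _ Kh.
rewrite imvalN -subr_eq0 opprK in nK; rewrite -subr_eq0 in nH.
move/eqP: e1; move/eqP: e2; rewrite !mulf_eq0 (negPf nK) (negPf nH) /=.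
by move=> /eqP ? /eqP ?; lra.
Qed.

End SkewModule.

(** * Nondegeneracy of the pairing with a root vector *)

Section WeightPairing.
Variables (R : realType) (g U : vectType R) (h0 : {vspace g}).
Variables (br : {bilinear g -> g -> g}) (act : {bilinear g -> U -> U}).
Variables (ipg : {biscalar g}) (ipU : {biscalar U}).
Hypothesis br_lie : is_lie_bracket br.
Hypothesis h0_max : is_maximal_abelian br h0.
Hypothesis act_lie : is_lie_module br act.
Hypothesis ipg_inner : is_inner_product ipg.
Hypothesis ipU_inner : is_inner_product ipU.
Hypothesis br_skew : forall z x y, ipg (br z x) y = - ipg x (br z y).
Hypothesis act_skew : forall z x y, ipU (act z x) y = - ipU x (act z y).
Implicit Types (l m b : cartan_dual h0) (H A B T : g).

Lemma bracketC x y : br x y = - br y x.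
Proof.
have [alt _] := br_lie; apply/eqP; rewrite -addr_eq0.
by have := alt (x + y); rewrite linearDl !linearDr !alt add0r addr0 => ->.
Qed.

Lemma bracket_jacobi x y z : br x (br y z) = br (br x y) z + br y (br x z).
Proof.
have [_ /(_ x y z)] := br_lie => /eqP.
rewrite (bracketC z (br x y)) (bracketC z x) linearNr /=.
by rewrite -addrA -opprD subr_eq0 => /eqP ->; rewrite addrC.
Qed.

(** Otherwise h0 + <[T]> would be a larger abelian subspace. *)
Lemma centralizer_in_cartan T : (forall H, H \in h0 -> br H T = 0) -> T \in h0.
Proof.
move=> hT; have [hab hmax] := h0_max.
suff <- : (h0 + <[T]>)%VS = h0 by apply: (subvP (addvSr _ _)); rewrite memv_line.
apply: hmax; last exact: addvSl.
have [alt _] := br_lie.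
move=> _ _ /memv_addP[x xh [_ /vlineP[a ->] ->]] /memv_addP[y yh [_ /vlineP[c ->] ->]].
rewrite linearDl !linearDr !linearZl_LR !linearZr_LR /= alt hab // hT //.
by rewrite bracketC hT // oppr0 !scaler0 !addr0.
Qed.

Lemma act_comm H A u : act H (act A u) = act (br H A) u + act A (act H u).
Proof. by rewrite act_lie subrK. Qed.

(** Up to a scalar [A, B] is the bracket of A + i B with its conjugate, of weight
b - b = 0. *)
Lemma root_pair_bracket_cartan b A B : weight_pair br b A B -> br A B \in h0.
Proof.
move=> bAB; apply: centralizer_in_cartan => H Hh; have [HA HB] := bAB H Hh.
have [alt _] := br_lie.
by rewrite bracket_jacobi HA HB linearZl_LR linearZr_LR /= !alt !scaler0 addr0.
Qed.

Lemma root_pair_scale b A B : weight_pair br b A B ->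
  imval b (br A B) * ipg A A = - ipg (br A B) (br A B).
Proof.
move=> bAB; have [_ TB] := bAB _ (root_pair_bracket_cartan bAB).
have := congr1 (ipg^~ A) TB; rewrite linearZl_LR /= => <-.
by rewrite (bracketC (br A B)) linearNl br_skew opprK (bracketC B A) linearNr.
Qed.

(** By [root_pair_scale] the sign is that of - |[A, B]|^2, and [A, B] is nonzero
because <[A, B], H> = - a_b(H) |A|^2 for H in h0. *)
Lemma root_pair_bracket_neg b A B : imaginary b -> b <> 0 ->
  weight_pair br b A B -> A <> 0 -> imval b (br A B) < 0.
Proof.
move=> ib b0 bAB A0; have [H Hh nH] := imval_neq0 ib b0.
have AA : 0 < ipg A A by case: ipg_inner => _; apply; apply/eqP.
have [HA HB] := bAB _ Hh.
have T0 : br A B != 0.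
  apply/negP => /eqP T0.
  have : ipg (br A B) H = - (imval b H * ipg A A).
    by rewrite bracketC linearNl br_skew opprK bracketC linearNr (ipC ipg_inner) HB
      linearZl_LR.
  rewrite T0 linear0l => /esym/eqP; rewrite oppr_eq0 mulf_eq0 (negPf nH).
  by rewrite gt_eqF.
have TT : 0 < ipg (br A B) (br A B) by case: ipg_inner => _; apply.
by rewrite -(pmulr_llt0 _ AA) root_pair_scale // oppr_lt0.
Qed.

Section Orthogonal.
Variables (l m : cartan_dual h0) (A B : g).
Hypothesis rootAB : weight_pair br (l + m) A B.
Hypothesis perpA :
  forall x x', re_weight act l x -> re_weight act m x' -> ipU (act A x) x' = 0.
Hypothesis perpB :
  forall x x', re_weight act l x -> re_weight act m x' -> ipU (act B x) x' = 0.

(** The conjugate of A + i B lowers the weight by l + m, so it maps V_l to V_(-m),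
whose real parts lie in U_m; being also orthogonal to U_m, the image vanishes. *)
Lemma lowering_zero x y : weight_pair act l x y ->
  act A x = - act B y /\ act A y = act B x.
Proof.
move=> lxy.
have lx : re_weight act l x by exists y.
have ly : re_weight act l y by exists (- x); exact: weight_pair_rot.
(* Real and imaginary part of (A - i B) (x + i y), up to conjugation. *)
have mXv : weight_pair act m (act A x + act B y) (act B x - act A y).
  have := weight_pair_equivariant act_comm rootAB (weight_pair_conj lxy).
  by rewrite !linearNr opprK addrAC subrr add0r [X in weight_pair _ _ _ X]addrC.
have m1 : re_weight act m (act A x + act B y) by eexists; exact: mXv.
have m2 : re_weight act m (act B x - act A y).
  by eexists; exact: weight_pair_rot mXv.
split; apply/eqP.
  rewrite -addr_eq0; apply/eqP/(ip_eq0 ipU_inner).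
  by rewrite linearDl perpA // perpB // addr0.
rewrite eq_sym -subr_eq0; apply/eqP/(ip_eq0 ipU_inner).
by rewrite linearBl perpA // perpB // subr0.
Qed.

(** With A y = B x and B y = - A x the eigenvalue equation for T = [A, B] at y reads
a_l(T) |x|^2 = <T y, x> = |A x|^2 + |B x|^2. *)
Lemma lowering_zero_sign : imaginary l -> l = 0 \/ weights act l ->
  0 <= imval l (br A B).
Proof.
move=> il [->|/(imaginary_weightP _ il)[_ [x x0 [y lxy]]]]; first by rewrite imval0.
have [e1 e2] := lowering_zero lxy.
have [_ Ty] := lxy _ (root_pair_bracket_cartan rootAB).
have xx : 0 < ipU x x by case: ipU_inner => _; apply; apply/eqP.
rewrite -(pmulr_lge0 _ xx).
have := congr1 (ipU^~ x) Ty; rewrite linearZl_LR /= => <-.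
have -> : ipU (act (br A B) y) x = ipU (act A x) (act A x) + ipU (act B x) (act B x).
  have eB : act B y = - act A x by rewrite e1 opprK.
  by rewrite act_lie linearBl (act_skew A _ x) (act_skew B _ x) e2 eB linearNl !opprK.
by rewrite addr_ge0 // ip_ge0.
Qed.

End Orthogonal.

(** Orthogonality for A passes to B, since B is a multiple of [H, A] and U_l, U_m
are stable under H.  Then T = [A, B] has a_l(T) >= 0 and a_m(T) >= 0, which
contradicts a_(l + m)(T) < 0 unless A = 0. *)
Lemma root_pairing_nondegenerate l m A :
  imaginary l -> imaginary m -> l + m <> 0 ->
  l = 0 \/ weights act l -> m = 0 \/ weights act m ->
  re_weight br (l + m) A ->
  (forall x x', re_weight act l x -> re_weight act m x' -> ipU (act A x) x' = 0) ->
  A = 0.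
Proof.
move=> il im lm0 wl wm [B rootAB] perpA; apply: contrapT => A0.
have ilm := imaginaryD il im.
have [H Hh nH] := imval_neq0 ilm lm0; have [HA HB] := rootAB _ Hh.
have perpB x x' : re_weight act l x -> re_weight act m x' -> ipU (act B x) x' = 0.
  move=> lx mx'.
  have : ipU (act (br H A) x) x' = 0.
    rewrite act_lie linearBl act_skew !perpA ?subr0 ?oppr0 //; exact: re_weight_act.
  rewrite HA !linearZl_LR /= => /eqP.
  by rewrite mulf_eq0 oppr_eq0 (negPf nH) => /eqP.
have s1 := lowering_zero_sign rootAB perpA perpB il wl.
have s2 : 0 <= imval m (br A B).
  apply: (@lowering_zero_sign m l) => //; first by rewrite addrC.
    by move=> x x' mx lx'; rewrite act_skew (ipC ipU_inner) perpA ?oppr0.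
  by move=> x x' mx lx'; rewrite act_skew (ipC ipU_inner) perpB ?oppr0.
have := root_pair_bracket_neg ilm lm0 rootAB A0.
by rewrite imvalD ltNge addr_ge0.
Qed.

End WeightPairing.

(** * The bracket on U and its weights *)

Section MomentMap.
Variables (R : realType) (g U : vectType R) (h0 : {vspace g}).
Variables (br : {bilinear g -> g -> g}) (act : {bilinear g -> U -> U}).
Variables (ipg : {biscalar g}) (ipU : {biscalar U}).
Variable mom : {bilinear U -> U -> g}.
Hypothesis br_lie : is_lie_bracket br.
Hypothesis h0_max : is_maximal_abelian br h0.
Hypothesis act_lie : is_lie_module br act.
Hypothesis ipg_inner : is_inner_product ipg.
Hypothesis ipU_inner : is_inner_product ipU.
Hypothesis br_skew : forall z x y, ipg (br z x) y = - ipg x (br z y).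
Hypothesis act_skew : forall z x y, ipU (act z x) y = - ipU x (act z y).
Hypothesis momP : forall u v z, ipg (mom u v) z = ipU (act z u) v.
Implicit Types (l m : cartan_dual h0).

(** Skewness of both actions shows that the two sides have the same inner products
with all vectors of g. *)
Lemma mom_equivariant z u v : br z (mom u v) = mom (act z u) v + mom u (act z v).
Proof.
apply/eqP; rewrite -subr_eq0; apply/eqP/(ip_eq0 ipg_inner).
set w := (X in ipg _ X); rewrite linearBl linearDl br_skew !momP act_lie.
by rewrite linearBl (act_skew z) opprB opprK subrr.
Qed.

(** The vector mom u v commutes with h0, hence lies in h0, and kills u; so
|mom u v|^2 = <(mom u v) u, v> = 0. *)
Lemma mom_zero_zero u v : re_weight act (0 : cartan_dual h0) u ->
  re_weight act (0 : cartan_dual h0) v -> mom u v = 0.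
Proof.
move=> /re_weight_zeroE hu /re_weight_zeroE hv; apply: (ip_eq0 ipg_inner).
rewrite momP hu ?linear0l //; apply: (centralizer_in_cartan br_lie h0_max).
by move=> H Hh; rewrite mom_equivariant hu // hv // linear0l linear0r addr0.
Qed.

Definition mom_set l m : set g :=
  [set mom u v | u in re_weight act l & v in re_weight act m].

(** If x and y complete u and v to elements of V_l and V_m, the two components are
half of the real parts of mom(u + i x, v + i y) and of mom(u + i x, v - i y).
The first is again in the span since (x, y) is another pair of vectors of U_l
and U_m; this is what lets the two root spaces be treated separately. *)
Lemma mom_set_split l m w : mom_set l m w -> exists wp wm,
  [/\ w = wp + wm, linear_span (mom_set l m) wp,
      re_weight br (l + m) wp & re_weight br (l - m) wm].
Proof.
move=> [u [x lux] [v [y mvy] <-]].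
have p1 := weight_pair_equivariant mom_equivariant lux mvy.
have p2 := weight_pair_equivariant mom_equivariant lux (weight_pair_conj mvy).
exists (2^-1 *: (mom u v - mom x y)), (2^-1 *: (mom u v + mom x y)); split.
- rewrite -scalerDr addrACA addNr addr0 scalerDr -scalerDl -[LHS]scale1r.
  by congr (_ *: _); field.
- exists 2%N, (fun i : 'I_2 => if i == 0 then 2^-1 else - 2^-1),
    (fun i : 'I_2 => if i == 0 then mom u v else mom x y); split.
    move=> i; case: ifP => _; [exists u; last exists v|exists x; last exists y] => //.
    + by exists x.
    + by exists y.
    + by exists (- u); exact: weight_pair_rot.
    + by exists (- v); exact: weight_pair_rot.
  by rewrite big_ord_recl big_ord1 /= scaleNr -scalerBr.
- by apply: re_weightZ; eexists; exact: p1.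
- by apply: re_weightZ; rewrite linearNr opprK in p2; eexists; exact: p2.
Qed.

Lemma mom_set_perp l m z : imaginary l -> imaginary m -> l + m <> 0 ->
  l = 0 \/ weights act l -> m = 0 \/ weights act m -> re_weight br (l + m) z ->
  (forall w, mom_set l m w -> ipg z w = 0) -> z = 0.
Proof.
move=> il im lm wl wm lmz perp.
apply: (root_pairing_nondegenerate br_lie h0_max act_lie ipg_inner ipU_inner
  br_skew act_skew il im lm wl wm lmz) => x x' lx mx'.
by rewrite -momP (ipC ipg_inner) perp //; exists x => //; exists x'.
Qed.

Lemma linear_span_mom_zero l : weights act l ->
  linear_span (mom_set 0 l) = re_weight br l.
Proof.
move=> wl; have il := skew_weight_imaginary ipU_inner act_skew wl.
have i0 := @imaginary0 _ _ h0; have [l0 _] := wl.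
apply: (linear_span_of_orthogonal ipg_inner).
- exact: re_weight0.
- by move=> a x y; exact: re_weight_linear.
- move=> _ /mom_set_split[wp [wm [-> _]]]; rewrite !add0r => lp /re_weightN lm.
  exact: re_weightD.
- move=> z lz; apply: mom_set_perp => //; rewrite ?add0r //; last by right.
  by left.
Qed.

Lemma ip_linear_span z (S : set g) : (forall w, S w -> ipg z w = 0) ->
  forall w, linear_span S w -> ipg z w = 0.
Proof.
move=> zS _ [n [c [s [Ss ->]]]]; rewrite linear_sumr big1 // => i _.
by rewrite linearZr_LR /= zS ?mulr0.
Qed.

Lemma re_roots_orthogonal l m x y : imaginary l -> imaginary m ->
  l <> 0 -> m <> 0 -> re_weight br (l + m) x -> re_weight br (l - m) y ->
  ipg x y = 0.
Proof.
move=> il im l0 m0 px py; apply: (re_weight_orthogonal br_skew _ _ _ _ px py).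
- exact: imaginaryD.
- exact/imaginaryD/imaginaryN.
- move=> /addrI mN; have [H Hh /eqP[]] := imval_neq0 im m0.
  by have := congr1 (@imval _ _ _ ^~ H) mN; rewrite imvalN; lra.
- rewrite opprB => e; have [H Hh /eqP[]] := imval_neq0 il l0.
  by have := congr1 (@imval _ _ _ ^~ H) e; rewrite !imvalD imvalN; lra.
Qed.

(** An element xp + ym of the sum orthogonal to the span has both terms orthogonal
to it, because the components of generators are in the span and the two root
spaces are orthogonal to each other. *)
Lemma linear_span_mom l m : weights act l -> weights act m ->
  l + m <> 0 -> l - m <> 0 ->
  is_direct_sum (linear_span (mom_set l m)) (re_weight br (l + m)) (re_weight br (l - m)).
Proof.
move=> wl wm lm lNm.
have il := skew_weight_imaginary ipU_inner act_skew wl.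
have im := skew_weight_imaginary ipU_inner act_skew wm.
have [l0 _] := wl; have [m0 _] := wm.
have orth := re_roots_orthogonal il im l0 m0.
split; last first.
  apply/seteqP; split=> x /=; last by move=> ->; split; exact: re_weight0.
  by move=> [xp xm]; apply: (ip_eq0 ipg_inner); exact: orth.
apply: (linear_span_of_orthogonal ipg_inner).
- by exists 0; [|exists 0; rewrite ?addr0 //]; exact: re_weight0.
- move=> a _ _ [x xp [x' xm <-]] [y yp [y' ym <-]].
  exists (a *: x + y); first exact: re_weight_linear.
  exists (a *: x' + y'); first exact: re_weight_linear.
  by rewrite scalerDr addrACA.
- move=> _ /mom_set_split[wp [wm' [-> _ p q]]].
  by exists wp => //; exists wm'.
move=> _ [x xp [y ym <-]] perp.
have x0 w : mom_set l m w -> ipg x w = 0.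
  move=> /mom_set_split[wp [wm' [-> sp p q]]].
  rewrite linearDr (orth _ _ xp q) addr0.
  have := ip_linear_span perp sp.
  by rewrite linearDl (ipC ipg_inner y) (orth _ _ p ym) addr0.
have y0 w : mom_set l m w -> ipg y w = 0.
  by move=> lmw; have := perp _ lmw; rewrite linearDl x0 // add0r.
rewrite (mom_set_perp _ _ _ _ _ xp x0) ?add0r //; [|by right..].
apply: (@mom_set_perp l (- m)) => //; first exact: imaginaryN.
- by right.
- right; apply/imaginary_weightP; first exact: imaginaryN.
  have [_ [v v0 mv]] := (imaginary_weightP _ im).1 wm.
  split; first by move=> /eqP; rewrite oppr_eq0 => /eqP.
  by exists v => //; apply/re_weightN.
- by move=> w [u lu [v /re_weightN mv <-]]; apply: y0; exists u => //; exists v.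
Qed.

End MomentMap.

(** * Common eigenvectors of commuting operators *)

(** The value at H1 + i H2 is i (a(H1) + i a(H2)). *)
Lemma functional_of_imval (R : realType) (g : vectType R) (h0 : {vspace g})
    (a : g -> R) : (forall c x y, a (c *: x + y) = c * a x + a y) ->
  exists2 l : cartan_dual h0, imaginary l & forall H, H \in h0 -> imval l H = a H.
Proof.
move=> alin.
have a0 : a 0 = 0 by have := alin 1 0 0; rewrite scale1r addr0 => ?; lra.
pose f (H : cartan h0) : R[i]^o := Complex (- a (vsval H.2)) (a (vsval H.1)).
have flin : linear f.
  move=> [p q] [x y] [x' y']; rewrite complexification_scaleE /f /=.
  congr Complex; rewrite -addrA; first by rewrite !alin; ring.
  by rewrite -scaleNr !alin; ring.
pose fL : {linear cartan h0 -> R[i]^o} :=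
  HB.pack f (GRing.isLinear.Build _ _ _ _ f flin).
exists (linfun fL) => [H|H Hh]; first by rewrite lfunE /= /f /= a0 oppr0.
by rewrite /imval lfunE /= vsprojK.
Qed.

Section CommonEigenvector.
Variables (R : realType) (g W : vectType R) (act : {bilinear g -> W -> W}).
Variables (h0 : {vspace g}) (M : {vspace W}).
Import VectorInternalTheory.
Hypothesis act_comm : forall H K w, H \in h0 -> K \in h0 ->
  act H (act K w) = act K (act H w).
Hypothesis M_stable : forall H w, H \in h0 -> w \in M -> act H w \in M.
Hypothesis M_neq0 : M != 0%VS.

Local Notation n := (dim (subvs_of M)).

(** Matrix of the action of H on the subspace M, acting on row vectors. *)
Definition restriction_mx H : 'M[R]_n :=
  lin1_mx (v2r \o vsproj M \o act H \o vsval \o r2v).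

Lemma mul_restriction_mx H (r : 'rV[R]_n) : H \in h0 ->
  vsval (r2v (r *m restriction_mx H)) = act H (vsval (r2v r)).
Proof.
by move=> Hh; rewrite mul_rV_lin1 /= v2rK vsprojK // M_stable // subvsP.
Qed.

Lemma restriction_mx_comm H K : H \in h0 -> K \in h0 ->
  restriction_mx H *m restriction_mx K = restriction_mx K *m restriction_mx H.
Proof.
move=> Hh Kh; apply/row_matrixP => i; rewrite !rowE !mulmxA.
apply/(can_inj r2vK)/val_inj.
by rewrite /= !mul_restriction_mx // act_comm.
Qed.

(** Restricted to M and written as complex matrices, the basis vectors of h0 act by
commuting operators, which share an eigenvector u + i w; the eigenvalue equations
then extend linearly to h0. *)
Lemma common_eigenpair : exists x y, [/\ x \in M, y \in M, (x, y) <> (0, 0) &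
  forall H, H \in h0 -> exists p q,
    act H x = p *: x - q *: y /\ act H y = p *: y + q *: x].
Proof.
pose toC := @real_complex R.
pose As := [seq map_mx toC (restriction_mx H) | H <- vbasis h0].
have n_gt0 : (0 < n)%N by rewrite /dim /= lt0n dimv_eq0.
have [|v v0 /allP vAs] := @common_eigenvector R[i] n As n_gt0.
  move=> _ _ /mapP[H Hb ->] /mapP[K Kb ->]; rewrite /comm_mx -!map_mxM.
  by rewrite restriction_mx_comm // vbasis_mem.
pose u : 'rV[R]_n := map_mx (@complex.Re R) v.
pose w : 'rV[R]_n := map_mx (@complex.Im R) v.
exists (vsval (r2v u)), (vsval (r2v w)); split; rewrite ?subvsP //.
  move=> [u0 w0]; case/eqP: v0; apply/rowP => j.
  have : u = 0 by apply: (can_inj r2vK); apply: val_inj; rewrite /= u0 linear0.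
  have : w = 0 by apply: (can_inj r2vK); apply: val_inj; rewrite /= w0 linear0.
  move=> /rowP/(_ j) + /rowP/(_ j); rewrite !mxE.
  by case: (v 0 j) => a b /= -> ->.
move=> H /coord_vbasis ->; elim/big_rec: _ => [|i K _ [p [q [Kx Ky]]]].
  by exists 0, 0; rewrite !linear0l !scale0r subr0 addr0.
have bh : (vbasis h0)`_i \in h0 by rewrite vbasis_mem // mem_nth // size_tuple.
set b := (vbasis h0)`_i in bh *; set c := coord _ i H.
have : map_mx toC (restriction_mx b) \in As.
  by apply/mapP; exists b => //; rewrite mem_nth // size_tuple.
move=> /vAs /sub_rVP[[p' q'] vb].
have [eu ew] : u *m restriction_mx b = p' *: u - q' *: w /\
               w *m restriction_mx b = p' *: w + q' *: u.
  split; apply/rowP => j; have := congr1 (fun r : 'rV_n => r 0 j) vb; rewrite !mxE.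
    move=> /(congr1 (@complex.Re R)); rewrite raddf_sum /=.
    move=> e; have -> : p' * complex.Re (v 0 j) - q' * complex.Im (v 0 j) =
      complex.Re ((p' +i* q')%C * v 0 j) by case: (v 0 j).
    rewrite -e; apply: eq_bigr => k _; rewrite !mxE.
    by case: (v 0 k) => s t /=; rewrite mulr0 subr0.
  move=> /(congr1 (@complex.Im R)); rewrite raddf_sum /= => e.
  have -> : p' * complex.Im (v 0 j) + q' * complex.Re (v 0 j) =
    complex.Im ((p' +i* q')%C * v 0 j) by case: (v 0 j).
  rewrite -e; apply: eq_bigr => k _; rewrite !mxE.
  by case: (v 0 k) => s t /=; rewrite mulr0 add0r.
exists (c * p' + p), (c * q' + q).
rewrite !linearDl !linearZl_LR /= Kx Ky -!mul_restriction_mx // eu ew.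
rewrite !linearB !linearD !linearZ /=.
by rewrite !scalerDl !scalerA !(mulrC _ c); split; rewrite addrACA.
Qed.

End CommonEigenvector.

(** * The weight space decomposition *)

Section WeightDecomposition.
Variables (R : realType) (g W : vectType R) (h0 : {vspace g}).
Variables (act : {bilinear g -> W -> W}) (ip : {biscalar W}).
Hypothesis ip_inner : is_inner_product ip.
Hypothesis act_skew : forall z x y, ip (act z x) y = - ip x (act z y).
Hypothesis act_comm : forall H K w, H \in h0 -> K \in h0 ->
  act H (act K w) = act K (act H w).
Implicit Types (l m k : cartan_dual h0) (H : g).

(** For a common eigenvector x + i y the eigenvalues are imaginary by skewness, and
their imaginary part is recovered as
a(H) = (<H y, x> - <H x, y>) / (|x|^2 + |y|^2), which is linear in H. *)
Lemma weight_in_stable_subspace (M : {vspace W}) : M != 0%VS ->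
  (forall H w, H \in h0 -> w \in M -> act H w \in M) ->
  exists l x, [/\ imaginary l, re_weight act l x, x \in M & x <> 0].
Proof.
move=> M0 Mst.
have [x [y [xM yM v0 eig]]] := common_eigenpair act_comm Mst M0.
pose N := ip x x + ip y y.
have N0 : N != 0.
  rewrite paddr_eq0 ?ip_ge0 //; apply/negP => /andP[/eqP x0 /eqP y0].
  by apply: v0; congr pair; apply: (ip_eq0 ip_inner).
pose a H := (ip (act H y) x - ip (act H x) y) / N.
have [c u v|l il la] := functional_of_imval h0 (a := a).
  by rewrite /a !linearPl /=; field.
have lxy : weight_pair act l x y.
  move=> H Hh; have [p [q [Hx Hy]]] := eig H Hh.
  have p0 := skew_eigen_re ip_inner act_skew v0 Hx Hy.
  rewrite p0 !scale0r !add0r -?scaleNr in Hx Hy; rewrite la //.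
  suff -> : a H = q by [].
  rewrite /a Hx Hy !linearZl_LR /=.
  by apply: (canLR (mulfK N0)); rewrite /N; ring.
have [x0|x0] := pselect (x = 0); last by exists l, x; split=> //; exists y.
exists l, y; split=> //; first by exists (- x); exact: weight_pair_rot.
by move=> y0; apply: v0; rewrite x0 y0.
Qed.

(** The orthogonal complement of the span of all weight vectors is stable under h0;
if nonzero, it would contain a weight vector, orthogonal to itself. *)
Lemma weight_vectors_span : exists2 X : seq W,
  (forall x, x \in X -> exists2 l : cartan_dual h0, imaginary l & re_weight act l x) &
  forall w, w \in <<X>>%VS.
Proof.
have [X XS SX] := finite_spanning_subset
  [set x | exists2 l : cartan_dual h0, imaginary l & re_weight act l x].
exists X => // w.
(* The span of Y is the orthogonal complement of the span of X. *)
have [Y YS SY] := finite_spanning_subset [set v | forall x, x \in X -> ip v x = 0].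
have YP v : v \in <<Y>>%VS -> forall x, x \in X -> ip v x = 0.
  move=> vY x xX; rewrite (ipC ip_inner); apply: ip_span_eq0 vY => y yY.
  by rewrite (ipC ip_inner) (YS _ yY).
have [Y0|Y0] := eqVneq <<Y>>%VS 0%VS.
  have [e eX we] := orthogonal_projection ip_inner X w.
  by have := SY _ we; rewrite Y0 memv0 subr_eq0 => /eqP ->.
have [H v Hh vY|l [x [il lx xY x0]]] := weight_in_stable_subspace Y0.
  apply: SY => x /XS [l il lx]; rewrite act_skew (ip_span_eq0 (YP v vY)) ?oppr0 //.
  by apply: SX; exists l => //; exact: re_weight_act.
case: x0; apply: (ip_eq0 ip_inner); apply: ip_span_eq0 (YP x xY) _.
by apply: SX; exists l.
Qed.

(** A weight different from the weights of a finite spanning family of weight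
vectors, and from their opposites, would have weight vectors orthogonal to
everything. *)
Lemma finite_weights : finite_set (weights act : set (cartan_dual h0)).
Proof.
have [X XS Xfull] := weight_vectors_span.
have [f fP] : exists f : W -> cartan_dual h0,
    forall x, x \in X -> imaginary (f x) /\ re_weight act (f x) x.
  suff /choice[f fP] x : exists l : cartan_dual h0,
      x \in X -> imaginary l /\ re_weight act l x by exists f.
  have [/XS[l il lx]|xX] := boolP (x \in X); first by exists l.
  by exists 0.
apply: (@sub_finite_set _ _ [set` map f X ++ map (fun x => - f x) X]);
  last exact: finite_seq.
move=> l wl /=; have il := skew_weight_imaginary ip_inner act_skew wl.
have [_ [x x0 lx]] := (imaginary_weightP _ il).1 wl.
rewrite mem_cat; apply/negPn/negP; rewrite negb_or => /andP[/negP n1 /negP n2].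
apply/x0/(ip_eq0 ip_inner)/ip_span_eq0; last exact: Xfull.
move=> y yX; have [ify fy] := fP _ yX.
apply: (re_weight_orthogonal act_skew il ify _ _ lx fy) => e.
  by apply: n1; rewrite e; apply/mapP; exists y.
by apply: n2; rewrite e; apply/mapP; exists y.
Qed.

(** Existence: the vectors having a decomposition form a subspace containing all
weight vectors.  Uniqueness: the difference of two decompositions of a vector is
a vanishing sum of pairwise orthogonal terms. *)
Lemma weight_decomposition (Lp : set (cartan_dual h0)) :
  is_positive_half act Lp -> is_weight_decomposition act Lp.
Proof.
move=> [wLp LpN].
have Lpw l : Lp l -> weights act l by rewrite wLp; left.
have Lpi l : Lp l -> imaginary l.
  by move=> /Lpw wl; exact: (skew_weight_imaginary ip_inner act_skew wl).
have Lpn l k : Lp l -> Lp k -> l <> - k.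
  move=> Ll Lk e; have : (Lp `&` [set - i | i in Lp]) l by split=> //; exists k.
  by rewrite LpN.
have [r r_uniq LpE] : exists2 r : seq (cartan_dual h0), uniq r & Lp = [set` r].
  have : finite_set Lp by apply: sub_finite_set finite_weights => l /Lpw.
  move=> /finite_seqP[r ->]; exists (undup r); first exact: undup_uniq.
  by apply/seteqP; split=> l /=; rewrite mem_undup.
have sumE (F : cartan_dual h0 -> W) : \sum_(l \in Lp) F l = \sum_(l <- r) F l.
  by rewrite LpE -fsbig_seq.
have rLp l : l \in r <-> Lp l by rewrite LpE.
pose P w (p : W * (cartan_dual h0 -> W)) := [/\ re_weight act (0 : cartan_dual h0) p.1,
  forall l, Lp l -> re_weight act l (p.2 l), forall l, ~ Lp l -> p.2 l = 0
  & w = p.1 + \sum_(l <- r) p.2 l].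
have PE w p : [/\ real_zero_weight_space h0 act p.1,
        forall l, Lp l -> real_weight_space act l (p.2 l),
        forall l, ~ Lp l -> p.2 l = 0
      & w = p.1 + \sum_(l \in Lp) p.2 l] <-> P w p.
  rewrite real_zero_weight_spaceE sumE.
  by split=> -[? h ? ?]; split=> // l Ll; have := h l Ll;
    rewrite real_weight_spaceE //; exact: Lpi.
have P0 : P 0 (0, fun=> 0).
  split=> //=; first exact: re_weight0.
    by move=> l _; exact: re_weight0.
  by rewrite big1 // addr0.
have PP a w w' p p' : P w p -> P w' p' ->
    P (a *: w + w') (a *: p.1 + p'.1, fun l => a *: p.2 l + p'.2 l).
  move=> [p1 p2 p3 p4] [q1 q2 q3 q4]; split=> /=.
  - exact: re_weight_linear.
  - by move=> l Ll; apply: re_weight_linear; [exact: p2 | exact: q2].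
  - by move=> l nl; rewrite p3 // q3 // scaler0 addr0.
  - by rewrite big_split /= -scaler_sumr addrACA -scalerDr -p4 -q4.
have P_weight w l : imaginary l -> re_weight act l w -> exists p, P w p.
  move=> il lw.
  have [->|w0] := pselect (w = 0); first by eexists; exact: P0.
  have [l0|l0] := pselect (l = 0).
    exists (w, fun=> 0); split=> //=; first by rewrite -l0.
      by move=> k _; exact: re_weight0.
    by rewrite big1 // addr0.
  have [k Lk kw] : exists2 k, Lp k & re_weight act k w.
    have : weights act l by apply/imaginary_weightP => //; split=> //; exists w.
    rewrite wLp => -[Ll|[k Lk kl]]; first by exists l.
    by exists k => //; apply/re_weightN; rewrite kl.
  exists (0, fun j => if j == k then w else 0); split=> /=.
  - exact: re_weight0.
  - by move=> j _; case: eqP => [->|_] //; exact: re_weight0.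
  - by move=> j Lj; case: eqP => // jk; case: Lj; rewrite jk.
  - rewrite add0r (bigD1_seq k) ?eqxx //=; last exact/rLp.
    by rewrite big1 ?addr0 // => j /negPf ->.
move=> w.
have [p Pp] : exists p, P w p.
  have [X XS Xfull] := weight_vectors_span.
  rewrite (coord_span (X := in_tuple X) (Xfull w)).
  elim/big_rec: _ => [|i v _ [p Pp]]; first by eexists; exact: P0.
  have [l il li] := XS _ (mem_nth 0 (ltn_ord i)).
  have [q Pq] := P_weight _ _ il li.
  by eexists; exact: PP Pq Pp.
exists p; split=> [|q]; first exact/PE.
move=> /PE Pq; have := PP (- 1) _ _ _ _ Pq Pp.
rewrite scaleN1r addNr; set d := (X in P 0 X) => -[d0 d1 d2 d3].
have orth l x y : Lp l -> re_weight act (0 : cartan_dual h0) x ->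
    re_weight act l y -> ip x y = 0.
  move=> Ll zx ly; have [l0 _] := Lpw _ Ll.
  apply: (re_weight_orthogonal act_skew _ (Lpi _ Ll) _ _ zx ly).
  - exact: imaginary0.
  - by move=> e; apply: l0; rewrite -e.
  - by move=> /esym/eqP; rewrite oppr_eq0 => /eqP.
have d1_0 : d.1 = 0.
  apply: (ip_eq0 ip_inner); have := linear0r ip d.1.
  rewrite [X in ip _ X]d3 linearDr linear_sumr big_seq big1 ?addr0 // => l /rLp Ll.
  by apply: orth (d1 l Ll).
have d2_0 l : d.2 l = 0.
  have [Ll|/d2 //] := pselect (Lp l).
  apply: (ip_eq0 ip_inner); have := linear0l ip (d.2 l).
  rewrite [X in ip X _]d3 d1_0 add0r linear_sumlz.
  rewrite (bigD1_seq l) //=; last exact/rLp.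
  rewrite big_seq_cond big1 ?addr0 // => k /andP[/rLp Lk /eqP kl].
  apply: (re_weight_orthogonal act_skew (Lpi _ Lk) (Lpi _ Ll) kl _ (d1 k Lk) (d1 l Ll)).
  exact: Lpn.
move: d1_0 d2_0; rewrite /d /= scaleN1r => e1 e2.
rewrite [p]surjective_pairing [q]surjective_pairing; congr pair.
  by move/eqP: e1; rewrite addrC subr_eq0 => /eqP.
apply/funext => l; have := e2 l; rewrite scaleN1r addrC.
by move/eqP; rewrite subr_eq0 => /eqP.
Qed.

End WeightDecomposition.

(** * The two-step nilpotent Lie algebra *)

Section TwoStep.
Variables (R : realType) (g U : vectType R).

Fact inU_is_linear : linear (@inU R g U).
Proof. by move=> a u v; congr pair; rewrite /= scaler0 addr0. Qed.
HB.instance Definition _ := GRing.isLinear.Build R U (U * g)%type _ (@inU R g U)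
  inU_is_linear.

Fact ing_is_linear : linear (@ing R g U).
Proof. by move=> a x y; congr pair; rewrite /= scaler0 addr0. Qed.
HB.instance Definition _ := GRing.isLinear.Build R g (U * g)%type _ (@ing R g U)
  ing_is_linear.

Lemma ing_inj : injective (@ing R g U).
Proof. by move=> x y []. Qed.

Definition form_U (ip : {biscalar (U * g)%type}) (u v : U) : R := ip (inU g u) (inU g v).
Definition form_g (ip : {biscalar (U * g)%type}) (x y : g) : R := ip (ing U x) (ing U y).

Fact form_U_is_biscalar ip : bilinear_for *%R *%R (form_U ip).
Proof.
by split=> v a x y; rewrite /form_U linearP ?linearPl ?linearPr.
Qed.
HB.instance Definition _ ip :=
  bilinear_isBilinear.Build R U U R _ _ (form_U ip) (form_U_is_biscalar ip).

Fact form_g_is_biscalar ip : bilinear_for *%R *%R (form_g ip).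
Proof.
by split=> v a x y; rewrite /form_g linearP ?linearPl ?linearPr.
Qed.
HB.instance Definition _ ip :=
  bilinear_isBilinear.Build R g g R _ _ (form_g ip) (form_g_is_biscalar ip).

Definition bracket_U (nbr : {bilinear (U * g)%type -> (U * g)%type -> (U * g)%type})
  (u v : U) : g := (nbr (inU g u) (inU g v)).2.

Fact bracket_U_is_bilinear nbr : bilinear_for *:%R *:%R (bracket_U nbr).
Proof.
by split=> v a x y; rewrite /bracket_U linearP ?linearPl ?linearPr.
Qed.
HB.instance Definition _ nbr :=
  bilinear_isBilinear.Build R U U g _ _ (bracket_U nbr) (bracket_U_is_bilinear nbr).

Lemma linear_span_ing (S : set g) :
  linear_span (@ing R g U @` S) = @ing R g U @` linear_span S.
Proof.
apply/seteqP; split=> w /=.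
  move=> [n [c [s [Ss ->]]]].
  exists (\sum_(i < n) c i *: (s i).2).
    exists n, c, (fun i => (s i).2); split=> // i.
    by have [x Sx <-] := Ss i.
  rewrite linear_sum; apply: eq_bigr => i _; rewrite linearZ.
  by have [x _ <-] := Ss i.
move=> [_ [n [c [s [Ss ->]]]] <-].
exists n, c, (fun i => ing U (s i)); split=> [i|]; first by exists (s i).
by rewrite linear_sum; apply: eq_bigr => i _; rewrite linearZ.
Qed.

Lemma sum_set_ing (S T : set g) :
  @ing R g U @` sum_set S T = sum_set (@ing R g U @` S) (@ing R g U @` T).
Proof.
apply/seteqP; split=> w.
  move=> [_ [x Sx [y Ty <-]] <-]; exists (ing U x); first by exists x.
  by exists (ing U y); [exists y | rewrite -linearD].
move=> [_ [x Sx <-] [_ [y Ty <-] <-]]; exists (x + y); last by rewrite linearD.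
by exists x => //; exists y.
Qed.

Lemma is_direct_sum_ing (S A B : set g) : is_direct_sum S A B ->
  is_direct_sum (@ing R g U @` S) (@ing R g U @` A) (@ing R g U @` B).
Proof.
move=> [-> AB]; split; first exact: sum_set_ing.
have ing0 : ing U (0 : g) = 0 by rewrite linear0.
apply/seteqP; split=> w.
  move=> [[x Ax <-] [y By /ing_inj yx]]; suff -> : x = 0 by [].
  by have : (A `&` B) x; [split=> //; rewrite -yx | rewrite AB].
move=> ->; have [A0 B0] : (A `&` B) 0 by rewrite AB.
by split; exists 0.
Qed.

(** All brackets land in g, so spans in n0 may be computed in g. *)
Lemma bracket_span_inU (h0 : {vspace g}) (act : {bilinear g -> U -> U}) ip nbr
    (l m : cartan_dual h0) : is_two_step_bracket act ip nbr ->
  bracket_span nbr (@inU R g U @` re_weight act l) (@inU R g U @` re_weight act m) =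
  @ing R g U @` linear_span (mom_set act (bracket_U nbr) l m).
Proof.
move=> [_ _ nbr_g _]; rewrite -linear_span_ing; congr linear_span.
have nbrE u v : nbr (inU g u) (inU g v) = ing U (bracket_U nbr u v).
  by rewrite /bracket_U; have [x ->] := nbr_g (inU g u) (inU g v).
apply/seteqP; split=> w.
  move=> [_ [u lu <-] [_ [v mv <-] <-]]; rewrite nbrE.
  by exists (bracket_U nbr u v) => //; exists u => //; exists v.
move=> [_ [u lu [v mv <-]] <-]; rewrite -nbrE.
by exists (inU g u); [exists u | exists (inU g v) => //; exists v].
Qed.

End TwoStep.

(** If b is not a root, the weight space of b is zero, in agreement with the
convention for g_(0, b). *)
Lemma real_root_spaceE (R : realType) (g : vectType R) (h0 : {vspace g})
    (br : {bilinear g -> g -> g}) (b : cartan_dual h0) :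
  imaginary b -> b <> 0 -> real_root_space br b = re_weight br b.
Proof.
move=> ib b0; rewrite /real_root_space; case: asboolP => [_|nb].
  exact: real_weight_spaceE.
apply/seteqP; split=> x /=; first by move=> ->; exact: re_weight0.
move=> bx; apply: contrapT => x0; apply: nb.
by apply/imaginary_weightP => //; split=> //; exists x.
Qed.

Theorem proposition6p7 (R : realType) (g0 U : vectType R)
    (br : {bilinear g0 -> g0 -> g0}) (h0 : {vspace g0})
    (act : {bilinear g0 -> U -> U})
    (ip : {biscalar (U * g0)%type})
    (nbr : {bilinear (U * g0)%type -> (U * g0)%type -> (U * g0)%type}) :
  is_compact_semisimple br ->
  is_maximal_abelian br h0 ->
  is_lie_module br act ->
  is_adapted_inner_product br act ip ->
  is_two_step_bracket act ip nbr ->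
  let Lambda : set (cartan_dual h0) := weights act in
  let U0 : set (U * g0)%type := @inU R g0 U @` real_zero_weight_space h0 act in
  let Uw (l : cartan_dual h0) : set (U * g0)%type :=
    @inU R g0 U @` real_weight_space act l in
  let g0w (l : cartan_dual h0) : set (U * g0)%type :=
    @ing R g0 U @` real_root_space br l in
  [/\ forall Lambdap : set (cartan_dual h0),
        is_positive_half act Lambdap -> is_weight_decomposition act Lambdap,
      forall l, Lambda l -> bracket_span nbr U0 (Uw l) = g0w l,
      forall m l, Lambda m -> Lambda l -> m + l <> 0 -> m - l <> 0 ->
        is_direct_sum (bracket_span nbr (Uw m) (Uw l)) (g0w (m + l)) (g0w (m - l))
    & bracket_span nbr U0 U0 = [set 0]].
Proof.
move=> [br_lie _] h0_max act_lie ip_adapted nbr_two_step /=.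
have [[ipC ip_pos] _ act_skew br_skew] := ip_adapted.
have [_ _ nbr_g nbrP] := nbr_two_step.
have ipU_inner : is_inner_product (form_U ip).
  split=> [u v|u u0]; first exact: ipC.
  by apply: ip_pos; apply: contraNneq u0 => -[->].
have ipg_inner : is_inner_product (form_g ip).
  split=> [x y|x x0]; first exact: ipC.
  by apply: ip_pos; apply: contraNneq x0 => -[->].
have skewU z u v : form_U ip (act z u) v = - form_U ip u (act z v).
  exact: act_skew.
have skewg z x y : form_g ip (br z x) y = - form_g ip x (br z y).
  exact: br_skew.
have momP u v z : form_g ip (bracket_U nbr u v) z = form_U ip (act z u) v.
  rewrite /form_U -nbrP /form_g /bracket_U.
  by have [x ->] := nbr_g (inU g0 u) (inU g0 v).
have wi (l : cartan_dual h0) : weights act l -> imaginary l.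
  by move=> wl; exact: (skew_weight_imaginary ipU_inner skewU wl).
rewrite real_zero_weight_spaceE; split.
- move=> Lp; apply: (weight_decomposition ipU_inner skewU) => H K u Hh Kh.
  have [hab _] := h0_max; have := act_lie H K u.
  by rewrite hab // linear0l => /esym/eqP; rewrite subr_eq0 => /eqP.
- move=> l wl; have il := wi _ wl; have [l0 _] := wl.
  rewrite real_weight_spaceE // (bracket_span_inU _ _ nbr_two_step).
  rewrite (linear_span_mom_zero br_lie h0_max act_lie ipg_inner ipU_inner skewg
    skewU momP) //.
  by rewrite real_root_spaceE.
- move=> m l wm wl ml mNl; have il := wi _ wl; have im := wi _ wm.
  rewrite !real_weight_spaceE // (bracket_span_inU _ _ nbr_two_step).
  rewrite !real_root_spaceE //; [|exact/imaginaryD/imaginaryN|exact: imaginaryD].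
  apply: is_direct_sum_ing.
  exact: (linear_span_mom br_lie h0_max act_lie ipg_inner ipU_inner skewg skewU momP).
- rewrite (bracket_span_inU _ _ nbr_two_step).
  have B0 := mom_zero_zero br_lie h0_max act_lie ipg_inner skewg skewU momP.
  apply/seteqP; split=> w /=.
    move=> [_ [n [c [s [Ss ->]]]] <-]; rewrite big1 ?linear0 // => i _.
    by have [u u0 [v v0 <-]] := Ss i; rewrite /= B0 // scaler0.
  move=> ->; exists 0; last by rewrite linear0.
  exists 0%N, (fun=> 0), (fun=> 0); split; first by case.
  by rewrite big_ord0.
Qed.
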